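(* Let $\lambda$ be a shape and $X\subseteq\mathrm{Seg}(\lambda)$. There exists $F\in\mathrm{GT}(\lambda)$ such that $X=\mathrm{Des}(F)$ if and only if $X$ is a face of the nonfriendly complex $\Gamma^{NF}(\lambda)$.
   Context: A shape is a finite vertex-induced subgraph $\lambda$ of the square grid $\mathbb{Z}^2$ (two points are adjacent iff they differ by 1 in exactly one coordinate and agree in the other). $(a,b)$ is immediately South of $(a,b+1)$ and immediately East of $(a-1,b)$; North and West are the reverse relations. A vertex of $\lambda$ is interior if all four of its grid neighbors are in $\lambda$, and a boundary vertex otherwise. A (boundary) path is a sequence of vertices $(v_0,\ldots,v_l)$ of $\lambda$, $l>0$, with $v_0,v_l$ boundary vertices, $v_1,\dots,v_{l-1}$ interior vertices, and each $v_i$ immediately South or East of $v_{i-1}$. A segment is a sequence of interior vertices $(v_0,\ldots,v_l)$, $l\ge 0$, with each $v_i$ immediately South or East of $v_{i-1}$; $\mathrm{Seg}(\lambda)$ is the set of segments. If $t=(v_i,\dots,v_j)$ is a contiguous subsequence of a path or segment $p=(v_0,\dots,v_l)$, then $p$ starts with $t$ if $i=0$ and otherwise enters $t$ from the West (resp. North) if $v_{i-1}$ is immediately West (resp. North) of $v_i$; $p$ ends with $t$ if $j=l$ and otherwise leaves $t$ to the East (resp. South) if $v_{j+1}$ is immediately East (resp. South) of $v_j$. Two segments $s,t$ are friendly along a common subsegment $u$ if, up to exchanging $s$ and $t$: $s$ starts with $u$ or enters $u$ from the West, and $s$ ends with $u$ or leaves $u$ to the South; and $t$ starts with $u$ or enters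 $u$ from the North, and $t$ ends with $u$ or leaves $u$ to the East. $\Gamma^{NF}(\lambda)$ is the simplicial complex of sets of segments (including $\emptyset$) whose distinct members are pairwise not friendly along any segment. Two paths $p,q$ kiss along a common segment $s$ if (up to exchanging) $p$ enters $s$ from the West and leaves to the South, while $q$ enters $s$ from the North and leaves to the East. The reduced nonkissing complex $\widetilde\Delta^{NK}(\lambda)$ has as faces the sets of pairwise nonkissing paths that are neither horizontal (only East steps) nor vertical (only South steps). It is known to be pure and thin (each codimension-1 face lies in exactly two facets), and if $F,F'$ are facets with $F\setminus\{p\}=F'\setminus\{q\}$, $p\ne q$, then $p,q$ kiss along a unique segment $s$. Write $F\xrightarrow{s}F'$ (a flip) if here $p$ enters $s$ from the West and leaves to the South and $q$ enters $s$ from the North and leaves to the East. The Grid-Tamari order $\mathrm{GT}(\lambda)$ is the poset on facets of $\widetilde\Delta^{NK}(\lambda)$ with $F\le F'$ iff $F'$ is obtained from $F$ by a (possibly empty) sequence of flips; it is known to be a congruence-uniform lattice whose Hasse diagram is the graph of flips. The descent set $\mathrm{Des}(F)$ of a facet $F$ is the set of segments $s$ such that $F'\xrightarrow{s}F$ for some facet $F'$. *)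

(* Defs.v *)
From mathcomp Require Import all_boot all_order all_algebra finmap.
From mathcomp Require Import boolp classical_sets.

Set Implicit Arguments.
Unset Strict Implicit.
Unset Printing Implicit Defensive.
Import Order.TTheory GRing.Theory Num.Theory.
Local Open Scope ring_scope.
Local Open Scope classical_set_scope.

Notation vertex := (int * int)%type.

(* A shape, being a vertex-induced subgraph of the grid, is represented by its
   finite set of vertices [lam : {fset vertex}]. *)

Definition east (v : vertex) : vertex := (v.1 + 1, v.2).
Definition west (v : vertex) : vertex := (v.1 - 1, v.2).
Definition north (v : vertex) : vertex := (v.1, v.2 + 1).
Definition south (v : vertex) : vertex := (v.1, v.2 - 1).

Definition interior (lam : {fset vertex}) (v : vertex) : bool :=
  [&& v \in lam, east v \in lam, west v \in lam, north v \in lam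
    & south v \in lam].

Definition boundary (lam : {fset vertex}) (v : vertex) : bool :=
  (v \in lam) && ~~ interior lam v.

Definition east_step : rel vertex := fun u v => v == east u.
Definition south_step : rel vertex := fun u v => v == south u.
Definition step : rel vertex := fun u v => south_step u v || east_step u v.

Definition Paths (lam : {fset vertex}) : set (seq vertex) :=
  [set p | exists (v0 vl : vertex) (m : seq vertex),
      [/\ p = v0 :: rcons m vl, sorted step p, boundary lam v0,
          boundary lam vl & all (interior lam) m]].

Definition Seg (lam : {fset vertex}) : set (seq vertex) :=
  [set s | [/\ s <> [::], sorted step s & all (interior lam) s]].

Definition horizontal (p : seq vertex) : bool := sorted east_step p.
Definition vertical (p : seq vertex) : bool := sorted south_step p.

(* [p] starts (ends) with [t] is [prefix t p] ([suffix t p]).  Walks with South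
   and East steps do not repeat vertices, so a nonempty [t] occurs at most once
   in [p] and each predicate below refers to that occurrence.  The default
   values of [head] and [last] make these predicates false when [t] is empty. *)

Definition enters_W (p t : seq vertex) : Prop :=
  exists (a b : seq vertex) (x : vertex),
    p = a ++ x :: t ++ b /\ x = west (head x t).

Definition enters_N (p t : seq vertex) : Prop :=
  exists (a b : seq vertex) (x : vertex),
    p = a ++ x :: t ++ b /\ x = north (head x t).

Definition leaves_E (p t : seq vertex) : Prop :=
  exists (a b : seq vertex) (y : vertex),
    p = a ++ t ++ y :: b /\ y = east (last y t).

Definition leaves_S (p t : seq vertex) : Prop :=
  exists (a b : seq vertex) (y : vertex),
    p = a ++ t ++ y :: b /\ y = south (last y t).

Definition common_segment (lam : {fset vertex}) (u p q : seq vertex) : Prop :=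
  [/\ Seg lam u, infix u p & infix u q].

(* The ordered relation underlying friendliness: the first segment plays the
   West/South role and the second one the North/East role. *)
Definition friendly_WS_NE (s t u : seq vertex) : Prop :=
  [/\ prefix u s \/ enters_W s u, suffix u s \/ leaves_S s u,
      prefix u t \/ enters_N t u & suffix u t \/ leaves_E t u].

Definition friendly (lam : {fset vertex}) (s t u : seq vertex) : Prop :=
  common_segment lam u s t /\ (friendly_WS_NE s t u \/ friendly_WS_NE t s u).

(* The nonfriendly complex, as the set of its faces. *)
Definition GammaNF (lam : {fset vertex}) : set (set (seq vertex)) :=
  [set X | X `<=` Seg lam /\
    forall s t, X s -> X t -> s <> t -> forall u, ~ friendly lam s t u].

Definition kiss_WS_NE (p q s : seq vertex) : Prop :=
  [/\ enters_W p s, leaves_S p s, enters_N q s & leaves_E q s].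

Definition kiss (lam : {fset vertex}) (p q s : seq vertex) : Prop :=
  common_segment lam s p q /\ (kiss_WS_NE p q s \/ kiss_WS_NE q p s).

(* The reduced nonkissing complex, as the set of its faces. *)
Definition DeltaNK (lam : {fset vertex}) : set (set (seq vertex)) :=
  [set F | [/\ F `<=` Paths lam,
    forall p, F p -> ~~ horizontal p /\ ~~ vertical p &
    forall p q, F p -> F q -> p <> q -> forall s, ~ kiss lam p q s]].

Definition facets (D : set (set (seq vertex))) : set (set (seq vertex)) :=
  [set F | D F /\ forall G, D G -> F `<=` G -> G = F].

(* The underlying set of the Grid-Tamari order. *)
Definition GT (lam : {fset vertex}) : set (set (seq vertex)) :=
  facets (DeltaNK lam).

Definition flip (lam : {fset vertex}) (s : seq vertex)
    (F F' : set (seq vertex)) : Prop :=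
  [/\ GT lam F, GT lam F' &
    exists p q : seq vertex,
      [/\ F p /\ F' q, p <> q, F `\ p = F' `\ q,
          common_segment lam s p q & kiss_WS_NE p q s]].

Inductive GT_le (lam : {fset vertex}) (F : set (seq vertex)) :
    set (seq vertex) -> Prop :=
| GT_le_refl : GT lam F -> GT_le lam F F
| GT_le_flip s F' F'' : GT_le lam F F' -> flip lam s F' F'' -> GT_le lam F F''.

Definition Des (lam : {fset vertex}) (F : set (seq vertex)) :
    set (seq vertex) :=
  [set s | Seg lam s /\ exists F', flip lam s F' F].

(* Main.v *)
Require Import Defs.
From mathcomp Require Import all_boot all_order all_algebra finmap.
From mathcomp Require Import boolp classical_sets.
From mathcomp Require Import zify.

Set Implicit Arguments.
Unset Strict Implicit.
Unset Printing Implicit Defensive.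
Local Open Scope classical_set_scope.

(* Call a set [B] of segments biclosed if it and its complement are closed
   under concatenation. Let [cell B] consist of the bent paths [p] such that
   every segment along which [p] goes from North to East is in [B] and none
   along which [p] goes from West to South is. Paths of [cell B] do not kiss,
   and starting from any edge the set [B] dictates how to extend it to a path
   of [cell B]; every bent path outside [cell B] kisses one of these, so [cell
   B] is a facet. For a set [Y] of walks, the concatenations of the segments
   along which members of [Y] run from North to East (starting or ending there
   being allowed) form a biclosed set [gen Y], and each facet [F] is [cell
   (gen F)]. Each element of [gen Y] contains, in the West-South position, one
   of the segments generating it; hence when [X] is nonfriendly no proper
   West-South part of [s] in [X] is in [gen X]. Then discarding from [gen X]
   the segments containing [s] in the North-East position gives a biclosed set
   whose cell differs from [cell (gen X)] by one path, exchanged along [s]; so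
   [X] consists of descents of [cell (gen X)]. Any descent is in [gen X],
   hence friendly with some [x] in [X] or equal to it, and descents of one
   facet are never friendly. *)

(** * Walks and their subsegments *)

Definition move (d : bool) (v : vertex) : vertex :=
  if d then east v else south v.

Lemma move_inj d d' v : move d v = move d' v -> d = d'.
Proof.
by case: d d' => -[] //; case: v => x y; rewrite /move /east /south /=;
   move=> [] ? ?; lia.
Qed.

Lemma stepP u v : reflect (exists d, v = move d u) (step u v).
Proof.
apply: (iffP orP) => [[/eqP ->|/eqP ->]|[[] ->]].
- by exists false.
- by exists true.
- by right; apply/eqP.
- by left; apply/eqP.
Qed.

(** Each step raises the difference of the two coordinates by one. *)
Lemma step_uniq p : sorted step p -> uniq p.
Proof.
pose lt_diag (u v : vertex) := (u.1 - u.2 < v.1 - v.2)%R.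
have le_step : subrel step lt_diag.
  move=> u v /stepP[d ->]; case: u => x y.
  by case: d; rewrite /lt_diag /move /east /south /=; lia.
move/(sub_sorted le_step); apply: sorted_uniq.
- by move=> u v w; rewrite /lt_diag; lia.
- by move=> u; rewrite /lt_diag; lia.
Qed.

Lemma cat_eq_cat (T : Type) (s t x y : seq T) : s ++ t = x ++ y ->
  (exists z, s = x ++ z /\ y = z ++ t) \/
  (exists z, [/\ z <> [::], x = s ++ z & t = z ++ y]).
Proof.
elim: s x => [|a s IH] [|b x] /=.
- by move=> ->; left; exists [::].
- by move=> ->; right; exists (b :: x).
- by move=> <-; left; exists (a :: s).
case=> <- /IH[[z [-> ->]]|[z [nz -> ->]]]; first by left; exists z.
by right; exists z.
Qed.

Lemma occurrence_unique (T : eqType) (u a b a' b' : seq T) : u != [::] ->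
  uniq (a ++ u ++ b) -> a ++ u ++ b = a' ++ u ++ b' -> a = a' /\ b = b'.
Proof.
case: u => // x u _ U E.
have idx c e : uniq (c ++ (x :: u) ++ e) -> index x (c ++ (x :: u) ++ e) = size c.
  rewrite cat_uniq index_cat /= negb_or => /and3P[_ /andP[/negPf -> _] _].
  by rewrite eqxx addn0.
have sz : size a = size a' by rewrite -(idx _ _ U) E idx // -E.
move/eqP: E; rewrite eqseq_cat // => /andP[/eqP -> ].
by rewrite eqseq_cat // => /andP[_ /eqP ->].
Qed.

Lemma uniq_cat_infixl (T : eqType) (s a b : seq T) : s != [::] ->
  uniq (a ++ s ++ b) -> ~~ infix s a.
Proof.
move=> s0 U; apply/negP => /infixP[x [y Ea]].
have E : a ++ s ++ b = x ++ s ++ (y ++ s ++ b) by rewrite {1}Ea -!catA.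
have [_ /(congr1 size)] := occurrence_unique s0 U E.
by rewrite !size_cat; case: s s0 {U E Ea} => //= z s _; lia.
Qed.

Lemma uniq_cat_infixr (T : eqType) (s a b : seq T) : s != [::] ->
  uniq (a ++ s ++ b) -> ~~ infix s b.
Proof.
move=> s0 U; apply/negP => /infixP[x [y Eb]].
have E : a ++ s ++ b = (a ++ s ++ x) ++ s ++ y by rewrite {1}Eb -!catA.
have [/(congr1 size) + _] := occurrence_unique s0 U E.
by rewrite !size_cat; case: s s0 {U E Eb} => //= z s _; lia.
Qed.

(* [joint d a b]: in a walk [a ++ b], the step from [a] to [b] is an East step
   if [d] is true and a South step otherwise; vacuous if [a] or [b] is empty. *)
Definition joint (d : bool) (a b : seq vertex) : bool :=
  if a is x :: a' then if b is y :: _ then y == move d (last x a') else true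
  else true.

Lemma joint_nilr d a : joint d a [::].
Proof. by case: a. Qed.

Lemma joint_catl d a1 a2 b : a2 != [::] -> joint d (a1 ++ a2) b = joint d a2 b.
Proof. by case: a1 a2 => [|x a1] [|y a2] //= _; rewrite last_cat. Qed.

Lemma joint_catr d a b1 b2 : b1 != [::] -> joint d a (b1 ++ b2) = joint d a b1.
Proof. by case: a b1 => [|x a] [|y b1]. Qed.

Lemma joint_inj d d' a b : a != [::] -> b != [::] ->
  joint d a b -> joint d' a b -> d = d'.
Proof.
by case: a b => [|x a] [|y b] //= _ _ /eqP -> /eqP; apply: move_inj.
Qed.

Lemma sorted_joint a b : sorted step (a ++ b) -> exists d, joint d a b.
Proof.
case: a b => [|x a] [|y b] //=; [by exists true..|].
by rewrite cat_path /= => /and3P[_ /stepP[d ->] _]; exists d.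
Qed.

Lemma sorted_moves_joint d a b :
  sorted (fun u v => v == move d u) (a ++ b) -> joint d a b.
Proof. by case: a b => [|x a] [|y b] //=; rewrite cat_path => /and3P[]. Qed.

Lemma sorted_catP a b d : sorted step a -> sorted step b -> joint d a b ->
  sorted step (a ++ b).
Proof.
case: a b => [|x a] [|y b] //=; first by rewrite cats0.
move=> Pa Pb /eqP E; rewrite cat_path Pa /= Pb andbT.
by apply/stepP; exists d.
Qed.

Lemma sorted_cat_inv a b :
  sorted step (a ++ b) -> sorted step a /\ sorted step b.
Proof.
case: a => //= x a; rewrite cat_path => /andP[-> Pb]; split=> //.
exact: path_sorted Pb.
Qed.

(* [sub true u p]: [p] starts with [u] or enters it from the North, and ends
   with [u] or leaves it to the East; [sub false u p]: the same with West and
   South. *)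
Definition sub (d : bool) (u p : seq vertex) : Prop :=
  exists a b, [/\ p = a ++ u ++ b, joint (~~ d) a u & joint d u b].

Lemma sub_self d u : sub d u u.
Proof. by exists [::], [::]; rewrite cats0 joint_nilr. Qed.

Lemma sub_size d u p : sub d u p -> size u <= size p.
Proof. by case=> a [b [-> _ _]]; rewrite !size_cat; lia. Qed.

Lemma sub_size_eq d u p : sub d u p -> size p <= size u -> u = p.
Proof.
case=> a [b [-> _ _]]; rewrite !size_cat => H.
have /size0nil -> : size a = 0 by lia.
have /size0nil -> : size b = 0 by lia.
by rewrite cats0.
Qed.

Lemma sub_trans d u v p : u != [::] -> sub d u v -> sub d v p -> sub d u p.
Proof.
move=> u0 [a [b [-> Ja Jb]]] [a' [b' [-> Ja' Jb']]].
exists (a' ++ a), (b ++ b'); rewrite -!catA; split=> //.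
- have [a0|a0] := eqVneq a [::]; last by rewrite joint_catl.
  by move: Ja'; rewrite a0 cats0 /= joint_catr.
- have [b0|b0] := eqVneq b [::]; last by rewrite joint_catr.
  by move: Jb'; rewrite b0 !cats0 joint_catl.
Qed.

Lemma subL d s t : joint d s t -> sub d s (s ++ t).
Proof. by exists [::], t. Qed.

Lemma subR d s t : joint d s t -> sub (~~ d) t (s ++ t).
Proof. by exists s, [::]; rewrite cats0 negbK joint_nilr. Qed.

(** The occurrence of [u] in [q] is unique, so a vertex of [s] next to [u] would be joined to it by
    one step having both directions. *)
Lemma sub_clash d u s q : sorted step q -> u != [::] -> infix s q ->
  sub d u s -> sub (~~ d) u q -> u = s.
Proof.
move=> /step_uniq Uq u0 /infixP[c [e Eq]] [a [b [Es Ja Jb]]] [a' [b' [Eq' Ja' Jb']]].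
have E : (c ++ a) ++ u ++ (b ++ e) = a' ++ u ++ b'.
  by rewrite -Eq' Eq Es -!catA.
have [Ea Eb] := occurrence_unique u0 (eq_ind _ uniq Uq _ (etrans Eq' (esym E))) E.
case: a Es Ja Ea {E} => [|x a] Es Ja Ea; last first.
  move: Ja'; rewrite -Ea joint_catl // => Ja'.
  by have := joint_inj _ _ Ja Ja'; case: (d) => /(_ isT u0).
case: b Es Jb Eb => [|x b] Es Jb Eb; last first.
  move: Jb'; rewrite -Eb joint_catr // => Jb'.
  by have := joint_inj _ _ Jb Jb'; case: (d) => /(_ u0 isT).
by rewrite Es cats0.
Qed.

Lemma sub_infix d u p : sub d u p -> infix u p.
Proof. by case=> a [b [-> _ _]]; apply/infixP; exists a, b. Qed.

Lemma cat_eq_cat3 (T : Type) (s t a u b : seq T) : s ++ t = a ++ u ++ b ->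
  [\/ exists b1, s = a ++ u ++ b1 /\ b = b1 ++ t,
      exists a2, t = a2 ++ u ++ b /\ a = s ++ a2 |
      exists u1 u2, [/\ u1 <> [::], u2 <> [::], u = u1 ++ u2, s = a ++ u1 &
        t = u2 ++ b]].
Proof.
case/cat_eq_cat=> [[z [-> /esym]]|[z [nz -> ->]]]; last first.
  by constructor 2; exists z.
case/cat_eq_cat=> [[y [-> ->]]|[y [ny -> ->]]].
  by constructor 1; exists y.
case: z => [|z0 z].
  by constructor 2; exists [::]; rewrite !cats0.
by constructor 3; exists (z0 :: z), y.
Qed.

(** When [u] straddles the cut, each half starts or ends at the cut, where no condition is imposed
    on it. *)
Lemma sub_cat d u s t : u != [::] -> sub d u (s ++ t) ->
  [\/ sub d u s, sub d u t |
      exists u1 u2, [/\ u1 != [::], u2 != [::], u = u1 ++ u2, sub d u1 s &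
        sub d u2 t]].
Proof.
move=> u0 [a [b [/cat_eq_cat3 E Ja Jb]]].
case: E => [[b1 [Es Eb]]|[a2 [Et Ea]]|[u1 [u2 [/eqP n1 /eqP n2 Eu Es Et]]]].
- constructor 1; exists a, b1; split=> //; move: Jb; rewrite Eb.
  by case: {Es Eb} b1 => [|x b1]; rewrite ?joint_nilr // joint_catr.
- constructor 2; exists a2, b; split=> //; move: Ja; rewrite Ea.
  by case: {Et Ea} a2 => [|x b1] //; rewrite joint_catl.
constructor 3; exists u1, u2; split=> //.
- exists a, [::]; rewrite cats0 joint_nilr; split=> //.
  by move: Ja; rewrite Eu joint_catr.
- exists [::], b; split=> //.
  by move: Jb; rewrite Eu joint_catl.
Qed.

Lemma Seg_neq0 lam u : Seg lam u -> u != [::].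
Proof. by case=> /eqP. Qed.

Lemma Seg_cat lam a u b : u != [::] -> Seg lam (a ++ u ++ b) -> Seg lam u.
Proof.
move=> u0 [_ /sorted_cat_inv[_ /sorted_cat_inv[S _]]].
by rewrite !all_cat => /and3P[_ I _]; split=> //; apply/eqP.
Qed.

Lemma Seg_sub lam d u s : u != [::] -> Seg lam s -> sub d u s -> Seg lam u.
Proof. by move=> u0 Ss [a [b [E _ _]]]; rewrite E in Ss; apply: Seg_cat Ss. Qed.

Lemma Paths_sorted lam p : Paths lam p -> sorted step p.
Proof. by case=> v [w [m []]]. Qed.

(** The end vertices of a path are not interior, so a segment never reaches them. *)
Lemma Paths_occ lam p a u b : Paths lam p -> Seg lam u -> p = a ++ u ++ b ->
  a != [::] /\ b != [::].
Proof.
case=> v [w [m [-> _ /andP[_ Bv] /andP[_ Bw] Im]]] [/eqP u0 _ Iu] E.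
split; apply/eqP => Z; move: E Iu; rewrite {}Z.
  by case: u u0 => //= x u _ [<- _] /andP[]; rewrite (negPf Bv).
rewrite cats0; case/lastP: u u0 => //= u x _.
rewrite -rcons_cat -rcons_cons => /rcons_inj[_ <-]; rewrite all_rcons => /andP[].
by rewrite (negPf Bw).
Qed.

Lemma Paths_Seg lam p a u b : Paths lam p -> p = a ++ u ++ b ->
  a != [::] -> u != [::] -> b != [::] -> Seg lam u.
Proof.
move=> Pp E a0 u0 b0; have := Paths_sorted Pp.
rewrite E => /sorted_cat_inv[_ /sorted_cat_inv[S _]]; split=> //; first exact/eqP.
case: Pp => v [w [m [-> _ _ _ Im]]] in E.
case: a b a0 b0 E => [|x a] // b _; case/lastP: b => // b y _.
rewrite -!rcons_cat /= => -[_ /rcons_inj[E _]].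
by move: Im; rewrite E !all_cat => /and3P[].
Qed.

Lemma Paths_sub_inj lam p d d' u : Paths lam p -> Seg lam u ->
  sub d u p -> sub d' u p -> d = d'.
Proof.
move=> Pp Su [a [b [E Ja Jb]]] [a' [b' [E' Ja' Jb']]].
have [a0 b0] := Paths_occ Pp Su E.
have Up := step_uniq (Paths_sorted Pp).
have [_ Eb] : a = a' /\ b = b'.
  apply: (occurrence_unique (Seg_neq0 Su)); rewrite -E //.
by rewrite -Eb in Jb'; apply: joint_inj (Seg_neq0 Su) b0 Jb Jb'.
Qed.

Lemma sub_bent lam p d u : Paths lam p -> Seg lam u -> sub d u p ->
  ~~ horizontal p /\ ~~ vertical p.
Proof.
move=> Pp Su [a [b [E Ja Jb]]]; have [a0 b0] := Paths_occ Pp Su E.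
have u0 := Seg_neq0 Su.
have NS e : ~ sorted (fun u v => v == move e u) p.
  move=> S; have J1 := S; have J2 := S.
  rewrite E in J1; rewrite E catA in J2.
  move/sorted_moves_joint: J1; rewrite joint_catr // => J1.
  move/sorted_moves_joint: J2; rewrite joint_catl // => J2.
  have := joint_inj a0 u0 J1 Ja; have := joint_inj u0 b0 J2 Jb.
  by move=> ->; case: (d).
by split; apply/negP; [apply: (NS true)|apply: (NS false)].
Qed.

Lemma cat_neq0r (T : eqType) (a b : seq T) : b != [::] -> a ++ b != [::].
Proof. by case: a. Qed.

Lemma cat_neq0l (T : eqType) (a b : seq T) : a != [::] -> a ++ b != [::].
Proof. by case: a. Qed.

Lemma size_catr (T : eqType) (a b : seq T) :
  b != [::] -> size a < size (a ++ b).
Proof. by rewrite -size_eq0 -lt0n size_cat -{1}[size a]addn0 ltn_add2l. Qed.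

Lemma size_catl (T : eqType) (a b : seq T) :
  a != [::] -> size b < size (a ++ b).
Proof. by rewrite -size_eq0 -lt0n size_cat -{1}[size b]add0n ltn_add2r. Qed.

(** * Walks dictated by a set of segments *)

Definition swap (v : vertex) : vertex := (v.2, v.1).

(* Reflecting across the diagonal and reversing walks is a symmetry of the
   theory that exchanges East steps with South steps and prefixes with
   suffixes. *)
Definition mirror (w : seq vertex) : seq vertex := rev (map swap w).

Lemma swapK : involutive swap.
Proof. by case. Qed.

Lemma mirrorK : involutive mirror.
Proof. by move=> w; rewrite /mirror map_rev revK mapK //; apply: swapK. Qed.

Lemma mirror_cat a b : mirror (a ++ b) = mirror b ++ mirror a.
Proof. by rewrite /mirror map_cat rev_cat. Qed.

Lemma mirror_cons x a : mirror (x :: a) = rcons (mirror a) (swap x).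
Proof. by rewrite /mirror /= rev_cons. Qed.

Lemma mirror_rcons x a : mirror (rcons a x) = swap x :: mirror a.
Proof. by rewrite /mirror map_rcons rev_rcons. Qed.

Lemma mirror_eq0 a : (mirror a == [::]) = (a == [::]).
Proof. by rewrite -!size_eq0 /mirror size_rev size_map. Qed.

Lemma joint_rcons d a x y b : joint d (rcons a x) (y :: b) = (y == move d x).
Proof. by case: a => //= z a; rewrite last_rcons. Qed.

(** Reflection turns an East step into a North step, which reversal reads as a South step. *)
Lemma joint_mirror d a b : joint d (mirror b) (mirror a) = joint (~~ d) a b.
Proof.
case/lastP: a => [|a x]; first exact: joint_nilr.
case: b => [|y b]; first by rewrite joint_nilr.
rewrite mirror_cons mirror_rcons !joint_rcons.
case: x y => [x1 x2] [y1 y2].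
case: d; rewrite /move /swap /east /south /=; apply/eqP/eqP => -[? ?];
  congr pair; lia.
Qed.

Lemma all_mirror I a : all I (mirror a) = all (I \o swap) a.
Proof. by rewrite /mirror all_rev all_map. Qed.

(* [follow B w] and [bfollow B w]: each step of [w] is dictated by the part of
   [w] preceding it (resp. following it). *)
Definition follow (B : seq vertex -> bool) (w : seq vertex) : Prop :=
  forall a b, w = a ++ b -> a != [::] -> joint (B a) a b.

Definition bfollow (B : seq vertex -> bool) (w : seq vertex) : Prop :=
  forall a b, w = a ++ b -> b != [::] -> joint (~~ B b) a b.

Definition terminal (I : pred vertex) (w : seq vertex) : Prop :=
  exists m v, [/\ w = rcons m v, all I m & ~~ I v].

Definition initial (I : pred vertex) (w : seq vertex) : Prop :=
  exists v m, [/\ w = v :: m, all I m & ~~ I v].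

Lemma bfollow_mirror B w : bfollow B w <-> follow (B \o mirror) (mirror w).
Proof.
split=> F a b E n0.
  rewrite -(mirrorK a) -(mirrorK b) joint_mirror /= mirrorK.
  by apply: F; rewrite ?mirror_eq0 // -mirror_cat -E mirrorK.
rewrite -[B b]/(B b) -joint_mirror -{1}(mirrorK b); apply: F.
  by rewrite E mirror_cat.
by rewrite mirror_eq0.
Qed.

Lemma initial_mirror I w : initial I w <-> terminal (I \o swap) (mirror w).
Proof.
split=> [[v [m [-> Im nv]]]|[m [v [E Im nv]]]].
  exists (mirror m), (swap v); rewrite mirror_cons all_mirror /=.
  split; rewrite ?swapK //.
  by rewrite (eq_all (a2 := I)) // => x /=; rewrite swapK.
exists (swap v), (mirror m); rewrite all_mirror; split=> //.
by rewrite -(mirrorK w) E mirror_rcons.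
Qed.

(** Prefixes are measured from the start of the walk, so dropping [x] changes the rule to
    [fun b => B (x :: b)]; hence the inductions below generalize [B]. *)
Lemma follow_cons B x y w :
  follow B (x :: y :: w) <->
  y = move (B [:: x]) x /\ follow (fun b => B (x :: b)) (y :: w).
Proof.
split=> [F|[E F]].
  split; first by have /eqP := F [:: x] (y :: w) erefl isT.
  move=> a b E n0.
  by have := F (x :: a) b; rewrite E /= => /(_ erefl isT); case: a n0 {E}.
case=> // z a b [<- ] Ew _.
case: a Ew => [/= <-|u a Ew]; first by rewrite -E.
by have := F _ _ Ew isT.
Qed.

Lemma terminal_cons I x w : w != [::] -> terminal I (x :: w) -> terminal I w.
Proof.
move=> w0 [[|y m] [v [/= E Im nv]]]; first by case: E w0 => _ ->.
by case: E Im => _ -> /andP[_ Im]; exists m, v.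
Qed.

Lemma terminal_neq0 I x w : terminal I (x :: w) -> I x -> w != [::].
Proof.
case=> m [v [E _ nv]] Ix; apply/eqP => w0; move: E; rewrite {}w0.
by case: m => [[E]|? []] //; rewrite -E Ix in nv.
Qed.

(** The dictated walk from [x] is deterministic and stops only outside [I], so it first runs through
    every dictated walk contained in [I]. *)
Lemma follow_prefix I B x w s : follow B (x :: w) -> terminal I (x :: w) ->
  follow B (x :: s) -> all I (x :: s) ->
  exists2 r, r != [::] & x :: w = (x :: s) ++ r.
Proof.
elim: s x w B => [|y s IH] x w B Fw Tw Fs /= /andP[Ix Is].
  by exists w => //; apply: terminal_neq0 Tw Ix.
have := terminal_neq0 Tw Ix; case: w Fw Tw => // z w Fw Tw _.
case/follow_cons: Fw => Ez Fw; case/follow_cons: Fs => Ey Fs.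
rewrite -Ey in Ez; rewrite Ez in Fw Tw *.
have [r r0 ->] := IH y w _ Fw (terminal_cons (w := y :: w) isT Tw) Fs Is.
by exists r.
Qed.

Lemma bfollow_suffix I B x w s : bfollow B (rcons w x) ->
  initial I (rcons w x) -> bfollow B (rcons s x) -> all I (rcons s x) ->
  exists2 c, c != [::] & rcons w x = c ++ rcons s x.
Proof.
move=> /bfollow_mirror Fw /initial_mirror Tw /bfollow_mirror Fs Is.
rewrite mirror_rcons in Fw Tw; rewrite mirror_rcons in Fs.
have [|r r0] := follow_prefix Fw Tw Fs.
  rewrite -mirror_rcons all_mirror (eq_all (a2 := I)) // => v /=.
  by rewrite swapK.
rewrite -!mirror_rcons => /(congr1 mirror).
rewrite mirror_cat !mirrorK => E; exists (mirror r) => //.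
by rewrite mirror_eq0.
Qed.

Lemma follow1 B x : follow B [:: x].
Proof.
case=> // y a b E _; have /eqP := congr1 size E; rewrite /= size_cat eqSS.
by rewrite eq_sym addn_eq0 => /andP[_ /nilP ->].
Qed.

(** The walk must leave [I], since each step raises the coordinate difference, which stays below [N]
    on [I]; the induction is on a bound [n] for the number of steps left. *)
Lemma follow_exists (I : pred vertex) (N : int) B x :
  (forall v, I v -> v.1 - v.2 < N)%R ->
  exists w, follow B (x :: w) /\ terminal I (x :: w).
Proof.
move=> bnd; have [n] : exists n : nat, (N <= x.1 - x.2 + n%:Z)%R.
  by exists `|(N - (x.1 - x.2))%R|%N; lia.
elim: n x B => [|n IH] x B len; have [Ix|nIx] := boolP (I x).
- by have := bnd _ Ix; lia.
- by exists [::]; split; [apply: follow1|exists [::], x].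
- have [|w [Fw [m [v [E Im nv]]]]] := IH (move (B [:: x]) x) (fun b => B (x :: b)).
    by move: len; case: x {Ix} => ? ?; case: (B _); rewrite /move /east /south /=; lia.
  exists (move (B [:: x]) x :: w); split; first exact/follow_cons.
  by exists (x :: m), v; rewrite E /= Ix.
- by exists [::]; split; [apply: follow1|exists [::], x].
Qed.

Lemma bfollow_exists (I : pred vertex) (N : int) B x :
  (forall v, I v -> N < v.1 - v.2)%R ->
  exists w, bfollow B (rcons w x) /\ initial I (rcons w x).
Proof.
move=> bnd.
have [|w [Fw Tw]] := @follow_exists (I \o swap) (- N)%R (B \o mirror) (swap x).
  by move=> v /= /bnd /=; lia.
exists (mirror w); split.
  by apply/bfollow_mirror; rewrite mirror_rcons mirrorK.
by apply/initial_mirror; rewrite mirror_rcons mirrorK.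
Qed.

Lemma diag_bounded (l : seq vertex) :
  exists N : int, forall v, v \in l -> (- N < v.1 - v.2 < N)%R.
Proof.
suff [N [N0 bnd]] : exists N : int, (0 < N)%R /\
    forall v, v \in l -> (- N < v.1 - v.2 < N)%R by exists N.
elim: l => [|[a b] l [N [N0 bnd]]]; first by exists 1%R.
exists (N + `|a - b|)%R; split=> [|v]; first lia.
by rewrite inE => /orP[/eqP -> /=|/bnd]; move: N0; set A := (a - b)%R; lia.
Qed.

Lemma sorted_of_joints w :
  (forall a b, w = a ++ b -> a != [::] -> b != [::] -> exists d, joint d a b) ->
  sorted step w.
Proof.
elim: w => // x [|y w] IH J //.
rewrite /= ; apply/andP; split.
  by have [d /eqP ->] := J [:: x] (y :: w) erefl isT isT; apply/stepP; exists d.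
apply: IH => a b E a0 b0; have [] := J (x :: a) b; rewrite ?E // => d.
by case: a a0 {E} => // z a _; exists d.
Qed.

Lemma interior_move lam d v : interior lam v -> move d v \in lam.
Proof. by case: d => /and5P[]. Qed.

Lemma interior_move_inv lam d v : interior lam (move d v) -> v \in lam.
Proof.
case: v => x y; case: d => /and5P[_ _ W Nn _].
  by move: W; rewrite /west /move /east /=; rewrite (_ : x + 1 - 1 = x)%R //; lia.
by move: Nn; rewrite /north /move /south /=; rewrite (_ : y - 1 + 1 = y)%R //; lia.
Qed.

(** The edge is prolonged both ways as [B] dictates. Each end of the result lies in [lam], being an
    end of the edge or a neighbor of an interior vertex. *)
Lemma edge_path lam B d a : a \in lam -> move d a \in lam ->
  exists l r, [/\ Paths lam (rcons l a ++ move d a :: r),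
    bfollow B (rcons l a), initial (interior lam) (rcons l a),
    follow B (move d a :: r) & terminal (interior lam) (move d a :: r)].
Proof.
move=> la lda.
have [N bnd] := diag_bounded lam.
have bi v : interior lam v -> (- N < v.1 - v.2 < N)%R by case/andP=> /bnd.
have [r [Fr Tr]] := @follow_exists (interior lam) N B (move d a)
  (fun v h => proj2 (andP (bi v h))).
have [l [Fl Il]] := @bfollow_exists (interior lam) (- N)%R B a
  (fun v h => proj1 (andP (bi v h))).
exists l, r; split=> //.
case: (Tr) => m1 [v1 [E1 Im1 nv1]]; case: (Il) => v0 [m0 [E0 Im0 nv0]].
have Sr : sorted step (move d a :: r).
  by apply: sorted_of_joints => x y E x0 _; exists (B x); apply: Fr.
have Sl : sorted step (rcons l a).
  by apply: sorted_of_joints => x y E _ y0; exists (~~ B y); apply: Fl.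
exists v0, v1, (m0 ++ m1); split.
- by rewrite E0 E1 /= rcons_cat.
- by apply: (sorted_catP (d := d)) => //; case: (l) => //= x l'; rewrite last_rcons.
- rewrite /boundary nv0 andbT.
  case: m0 E0 Im0 => [|y m0] E0 /=; first by case: (l) E0 => [[<-]|? []].
  case/andP=> Iy _; have := Fl [:: v0] (y :: m0) E0 isT.
  by move=> /eqP Ey; rewrite Ey in Iy; apply: interior_move_inv Iy.
- rewrite /boundary nv1 andbT.
  case/lastP: m1 E1 Im1 => [|m1 y] E1; first by case: E1 => <-.
  rewrite all_rcons => /andP[Iy _]; move: E1; rewrite -cats1 => E1.
  have := Fr _ _ E1; rewrite joint_rcons => H.
  by move: H => /(_ _)/eqP ->; [apply: interior_move|case: (m1)].
- by rewrite all_cat Im0.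
Qed.

(** * Facets from biclosed sets *)

(* Closure and coclosure under concatenation at once. *)
Definition biclosed lam (B : seq vertex -> bool) : Prop :=
  forall d s t, s != [::] -> t != [::] -> Seg lam (s ++ t) ->
    B s = d -> B t = d -> B (s ++ t) = d.

Definition compatible lam (B : seq vertex -> bool) (p : seq vertex) : Prop :=
  forall d u, Seg lam u -> sub d u p -> B u = d.

Definition cell lam (B : seq vertex -> bool) : set (seq vertex) :=
  [set p | [/\ Paths lam p, ~~ horizontal p /\ ~~ vertical p &
    compatible lam B p]].

(** If [u] straddles the edge, the steps around it give both halves the value [d], and closure
    applies. If [u] lies in [l], the step entering it gives [u ++ b1] the value [d], while the step
    leaving it gives [b1] the value [~~ d]; were [B u] also [~~ d], closure would be violated. The
    case of [r] is symmetric. *)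
Lemma edge_compatible lam B l r : biclosed lam B -> l != [::] -> r != [::] ->
  Paths lam (l ++ r) -> bfollow B l -> follow B r -> compatible lam B (l ++ r).
Proof.
move=> bB l0 r0 Pp Fl Fr d u Su [a [b [E Ja Jb]]].
have u0 := Seg_neq0 Su; have [a0 b0] := Paths_occ Pp Su E.
have [//|/eqP neq] := B u =P d; have Bu : B u = ~~ d by case: (B u) (d) neq => -[].
case/cat_eq_cat3: (E) => [[b1 [El Eb]]|[a2 [Er Ea]]|[u1 [u2 [/eqP n1 /eqP n2 Eu El Er]]]].
- have := Fl _ _ El (cat_neq0l _ u0); rewrite joint_catr // => Ja'.
  have Bub := negb_inj (joint_inj a0 u0 Ja Ja').
  have [b1z|b10] := eqVneq b1 [::]; first by rewrite Bub b1z cats0.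
  move: Jb; rewrite Eb joint_catr // => Jb.
  have := Fl (a ++ u) b1; rewrite -catA => /(_ El b10).
  rewrite joint_catl // => /(joint_inj u0 b10 Jb) Bb1.
  have Sub : Seg lam (u ++ b1).
    apply: (Paths_Seg Pp _ a0 (cat_neq0l _ u0) r0).
    by rewrite E Eb -!catA.
  by rewrite Bu {2}Bub; apply/esym/bB => //; rewrite Bb1 negbK.
- have := Fr (a2 ++ u) b; rewrite -catA => /(_ Er (cat_neq0r _ u0)).
  rewrite joint_catl // => /(joint_inj u0 b0 Jb) Bub.
  have [a2z|a20] := eqVneq a2 [::]; first by rewrite Bub a2z.
  move: Ja; rewrite Ea joint_catl // => Ja.
  have := Fr a2 (u ++ b) Er a20; rewrite joint_catr // => /(joint_inj a20 u0 Ja) Ba2.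
  have Sau : Seg lam (a2 ++ u).
    apply: (Paths_Seg Pp _ l0 (cat_neq0r _ u0) b0).
    by rewrite E Ea -!catA.
  by rewrite Bu {2}Bub; apply/esym/bB.
- have := Fl _ _ El n1; move: Ja; rewrite Eu joint_catr // => Ja.
  move=> /(joint_inj a0 n1 Ja) /negb_inj Bu1.
  have := Fr _ _ Er n2; move: Jb; rewrite Eu joint_catl // => Jb.
  move=> /(joint_inj n2 b0 Jb) Bu2.
  by apply: bB => //; rewrite -?Eu.
Qed.

Lemma cell_nokiss lam B d u p q : Seg lam u -> cell lam B p -> cell lam B q ->
  sub d u p -> sub (~~ d) u q -> False.
Proof.
move=> Su [_ _ Cp] [_ _ Cq] /(Cp _ _ Su) E /(Cq _ _ Su).
by rewrite E; case: d {E}.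
Qed.

Lemma sub_in_cell lam B d s p : Paths lam p -> Seg lam s -> sub d s p ->
  compatible lam B p -> cell lam B p.
Proof. by move=> Pp Ss Sp Cp; split=> //; exact: sub_bent Pp Ss Sp. Qed.

(* The path determined by the edge leaving [s] in direction [d]. *)
Lemma cell_through_fwd lam B d s : biclosed lam B -> Seg lam s -> B s = d ->
  bfollow B s -> exists c r, [/\ cell lam B (c ++ s ++ r), joint (~~ d) c s,
    joint d s r & follow B r].
Proof.
move=> bB Ss Bs Fs; have s0 := Seg_neq0 Ss.
case/lastP: s s0 Ss Bs Fs => // s y _ Ss Bs Fs.
have [_ _ Is] := Ss; have Iy : interior lam y.
  by move: Is; rewrite all_rcons => /andP[].
have yl : y \in lam by case/and5P: Iy.
have [l [r [Pp Fl Il Fr _]]] := @edge_path lam B d y yl (interior_move d Iy).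
(* As [s] obeys [bfollow], the backward walk from its last vertex runs through [s] first; the step
   entering [s] is then dictated by [B s]. *)
have [c c0 El] := bfollow_suffix Fl Il Fs Is.
have Jr : joint d (rcons s y) (move d y :: r) by rewrite joint_rcons.
have Jc : joint (~~ d) c (rcons s y).
  by rewrite -Bs; apply: (Fl _ _ El); case: (s).
have Cp := edge_compatible bB (_ : rcons l y != [::]) (isT : move d y :: r != [::]) Pp Fl Fr.
exists c, (move d y :: r); split=> //.
rewrite catA -El; apply: (sub_in_cell (d := d) Pp Ss); last by apply: Cp; case: (l).
by exists c, (move d y :: r); rewrite catA -El.
Qed.

(* The path determined by the edge entering [s], not in direction [d]. *)
Lemma cell_through_bwd lam B d s : biclosed lam B -> Seg lam s -> B s = d ->
  follow B s -> exists c r, [/\ cell lam B (c ++ s ++ r), joint (~~ d) c s,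
    joint d s r & bfollow B c].
Proof.
move=> bB Ss Bs Fs; have s0 := Seg_neq0 Ss.
case: s s0 Ss Bs Fs => // x s _ Ss Bs Fs.
have [_ _ Is] := Ss; have Ix : interior lam x by case/andP: Is.
have [y Ey] : exists y, x = move (~~ d) y.
  case: (x) (d) => x1 x2 [].
    by exists (x1, x2 + 1)%R; rewrite /move /south /=; congr pair; lia.
  by exists (x1 - 1, x2)%R; rewrite /move /east /=; congr pair; lia.
rewrite Ey in Ix.
have [l [r [Pp Fl _ Fr Tr]]] := @edge_path lam B (~~ d) y
  (interior_move_inv Ix) (proj1 (andP Ix)).
rewrite -Ey in Pp Fr Tr.
have [c c0 Er] := follow_prefix Fr Tr Fs Is.
have Jl : joint (~~ d) (rcons l y) (x :: s) by rewrite joint_rcons Ey.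
have Jc : joint d (x :: s) c by rewrite -Bs; apply: (Fr _ _ Er).
have Cp := edge_compatible bB (_ : rcons l y != [::]) (isT : x :: r != [::]) Pp Fl Fr.
exists (rcons l y), c; split=> //.
rewrite -Er; apply: (sub_in_cell (d := d) Pp Ss); last by apply: Cp; case: (l).
by exists (rcons l y), c; rewrite -Er.
Qed.

(** * Entering, leaving, kissing and friendliness in terms of [sub] *)

Lemma westE v x : (x = west v) <-> (v = move true x).
Proof.
case: v x => a b [c e]; rewrite /west /move /east /=.
by split=> -[-> ->]; congr pair; lia.
Qed.

Lemma northE v x : (x = north v) <-> (v = move false x).
Proof.
case: v x => a b [c e]; rewrite /north /move /south /=.
by split=> -[-> ->]; congr pair; lia.
Qed.

Definition enters (d : bool) := if d then enters_W else enters_N.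
Definition leaves (d : bool) := if d then leaves_E else leaves_S.

Lemma entersP d p u : u != [::] ->
  enters d p u <-> exists a b, [/\ p = a ++ u ++ b, joint d a u & a != [::]].
Proof.
case: u => // y u _.
suff -> : enters d p (y :: u) <->
    exists a b x, p = a ++ x :: (y :: u) ++ b /\ y = move d x.
  split=> [[a [b [x [-> E]]]]|[a [b [-> J a0]]]].
    exists (rcons a x), b; rewrite cat_rcons joint_rcons E; split=> //.
    by case: (a).
  case/lastP: a a0 J => // a' x _; rewrite joint_rcons => /eqP ->.
  by exists a', b, x; rewrite cat_rcons.
by case: d; split=> -[a [b [x [-> E]]]]; exists a, b, x; split=> //;
   apply/westE || apply/northE.
Qed.

Lemma leavesP d p u : u != [::] ->
  leaves d p u <-> exists a b, [/\ p = a ++ u ++ b, joint d u b & b != [::]].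
Proof.
case/lastP: u => // u y _.
suff -> : leaves d p (rcons u y) <->
    exists a b x, p = a ++ rcons u y ++ x :: b /\ x = move d y.
  split=> [[a [b [x [-> E]]]]|[a [b [-> J b0]]]].
    by exists a, (x :: b); rewrite joint_rcons E.
  case: b b0 J => // x b _; rewrite joint_rcons => /eqP ->.
  by exists a, b, (move d y).
by case: d; split=> -[a [b [x [-> E]]]]; exists a, b, x; split=> //;
  move: E; rewrite last_rcons.
Qed.

(** The entry and the exit condition each assert their own occurrence of [u]; uniqueness of the
    occurrence merges them into one decomposition. *)
Lemma subP d p u : sorted step p -> u != [::] ->
  sub d u p <->
    (prefix u p \/ enters (~~ d) p u) /\ (suffix u p \/ leaves d p u).
Proof.
move=> Sp u0; split.
  case=> a [b [-> Ja Jb]]; split.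
  - have [->|a0] := eqVneq a [::]; first by left; apply: prefix_prefix.
    by right; apply/entersP => //; exists a, b.
  - have [->|b0] := eqVneq b [::].
      by left; rewrite cats0; apply: suffix_suffix.
    by right; apply/leavesP => //; exists a, b.
have Up := step_uniq Sp.
case=> En Le.
have [a [b [E Ja]]] : exists a b, p = a ++ u ++ b /\ joint (~~ d) a u.
  case: En => [/prefixP[b ->]|]; first by exists [::], b.
  by move=> /(entersP _ _ u0)[a [b [-> J _]]]; exists a, b.
have [a' [b' [E' Jb]]] : exists a b, p = a ++ u ++ b /\ joint d u b.
  case: Le => [/suffixP[a2 ->]|]; first by exists a2, [::]; rewrite cats0 joint_nilr.
  by move=> /(leavesP _ _ u0)[a2 [b2 [-> J _]]]; exists a2, b2.
have [_ Eb] : a = a' /\ b = b'.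
  by apply: (occurrence_unique u0); rewrite -E.
by exists a, b; rewrite Eb in E *.
Qed.

Lemma kissP p q u : sorted step p -> sorted step q -> u != [::] ->
  kiss_WS_NE p q u -> sub false u p /\ sub true u q.
Proof.
by move=> Sp Sq u0 [? ? ? ?]; split; apply/subP => //; split; right.
Qed.

Lemma sub_kiss lam p q u : Paths lam p -> Paths lam q -> Seg lam u ->
  sub false u p -> sub true u q -> kiss_WS_NE p q u.
Proof.
move=> Pp Pq Su [a [b [E Ja Jb]]] [c [e [E' Jc Je]]].
have u0 := Seg_neq0 Su.
have [a0 b0] := Paths_occ Pp Su E; have [c0 e0] := Paths_occ Pq Su E'.
split.
- by apply/(entersP true _ u0); exists a, b.
- by apply/(leavesP false _ u0); exists a, b.
- by apply/(entersP false _ u0); exists c, e.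
- by apply/(leavesP true _ u0); exists c, e.
Qed.

Lemma friendlyP s t u : sorted step s -> sorted step t -> u != [::] ->
  friendly_WS_NE s t u <-> sub false u s /\ sub true u t.
Proof.
move=> Ss St u0; split=> [[? ? ? ?]|[]].
  by split; apply/subP.
by move=> /(subP _ Ss u0)[? ?] /(subP _ St u0)[? ?].
Qed.

(** The paths are automatically distinct, since one path cannot run along [u] in both positions. *)
Lemma face_nokiss lam F d u p q : DeltaNK lam F -> F p -> F q -> Seg lam u ->
  sub d u p -> sub (~~ d) u q -> False.
Proof.
move=> [FP _ NK] Fp Fq Su Sp Sq.
have pq : p <> q.
  move=> E; rewrite -E in Sq.
  by have := Paths_sub_inj (FP _ Fp) Su Sp Sq; case: (d).
apply: (NK _ _ Fp Fq pq u); split.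
  by split=> //; [apply: sub_infix Sp|apply: sub_infix Sq].
case: d Sp Sq => Sp Sq; [right|left];
  by apply: (sub_kiss (FP _ _) (FP _ _) Su).
Qed.

Lemma cell_face lam B : DeltaNK lam (cell lam B).
Proof.
split=> [p [] //|p [] //|p q Cp Cq pq s [[Ss _ _]]].
have [Pp _ _] := Cp; have [Pq _ _] := Cq; have s0 := Seg_neq0 Ss.
have Sp := Paths_sorted Pp; have Sq := Paths_sorted Pq.
case=> [/(kissP Sp Sq s0)|/(kissP Sq Sp s0)] [S1 S2].
  exact: cell_nokiss Ss Cp Cq S1 S2.
exact: cell_nokiss Ss Cq Cp S1 S2.
Qed.

(* A shortest subsegment [u] violating compatibility of [p] determines a path of
   the cell through [u] that kisses [p]. *)
Lemma cell_facet lam B : biclosed lam B -> GT lam (cell lam B).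
Proof.
move=> bB; split; first exact: cell_face.
move=> G DG sCG; rewrite eqEsubset; split=> // p Gp.
have [GP Gb _] := DG; split; [exact: GP|exact: Gb|].
suff H n : forall d u, size u < n -> Seg lam u -> sub d u p -> B u = d.
  by move=> d u; apply: (H (size u).+1).
elim: n => // n IH d u un Su Sup; apply/eqP/negPn/negP => /eqP Bd.
have Bu : B u = ~~ d by case: (B u) (d) Bd => -[].
have u0 := Seg_neq0 Su.
have [|c [r [Cr Jc Jr _]]] := cell_through_fwd bB Su Bu.
  (* Minimality makes [u] obey [bfollow]. After a step in direction [d], [a] has value [d], so [b]
     cannot, or [u] would have it by closure; after the other step, [b] itself has value [d]. *)
  move=> a b E b0.
  have [a0|a0] := eqVneq a [::]; first by rewrite a0.
  have az : 0 < size a by rewrite lt0n size_eq0.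
  have bz : 0 < size b by rewrite lt0n size_eq0.
  rewrite E size_cat in un.
  have Sa : Seg lam a by apply: (@Seg_cat _ [::] a b a0); rewrite -E.
  have Sb : Seg lam b by apply: (@Seg_cat _ a b [::] b0); rewrite cats0 -E.
  have [e J] : exists e, joint e a b.
    by apply: sorted_joint; rewrite -E; case: Su.
  have Ea : e = d -> B a = d.
    move=> ed; apply: IH => //; first lia.
    by apply: sub_trans Sup => //; rewrite E -ed; apply: subL.
  have Eb : e = ~~ d -> B b = d.
    move=> ed; apply: IH => //; first lia.
    by apply: sub_trans Sup => //; rewrite E -[d]negbK -ed; apply: subR.
  suff -> : ~~ B b = e by [].
  have [ed|ed] := eqVneq e d; last first.
    have ed' : e = ~~ d by case: (e) (d) ed => -[].
    by rewrite ed' Eb.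
  rewrite ed; apply: negb_inj; rewrite negbK.
  case: (B b =P ~~ d) => // nb.
  have Bb : B b = d by case: (B b) (d) nb => -[].
  by case: Bd; rewrite E; apply: bB => //; rewrite -?E //; apply: Ea.
apply: (face_nokiss DG Gp (sCG _ Cr) Su Sup).
by exists c, r.
Qed.

(** * Generated biclosed sets *)

Inductive conc (Q : seq vertex -> Prop) : seq vertex -> Prop :=
| conc1 u : Q u -> conc Q u
| conc_cat u t : Q u -> conc Q t -> conc Q (u ++ t).

Definition NE_parts lam (Y : set (seq vertex)) (u : seq vertex) : Prop :=
  Seg lam u /\ exists2 y, Y y & sub true u y.

Definition gen lam Y (u : seq vertex) : bool := `[< conc (NE_parts lam Y) u >].

Lemma NE_parts_sub lam Y u v : u != [::] -> NE_parts lam Y v -> sub true u v ->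
  NE_parts lam Y u.
Proof.
move=> u0 [Sv [y Yy Sy]] Suv; split; first exact: Seg_sub Sv Suv.
by exists y => //; apply: sub_trans Sy.
Qed.

Lemma conc_neq0 lam Y u : conc (NE_parts lam Y) u -> u != [::].
Proof.
case=> [v [/Seg_neq0 //]|v t [/Seg_neq0 v0 _] _].
exact: cat_neq0l.
Qed.

Lemma conc_app Q s t : conc Q s -> conc Q t -> conc Q (s ++ t).
Proof.
elim=> [u Qu|u s' Qu _ IH] Ct; first exact: conc_cat.
by rewrite -catA; apply: conc_cat (IH Ct).
Qed.

(** The factors of [s] cut [u] into pieces, each in North-East position in its factor. *)
Lemma conc_NE lam Y u s :
  u != [::] -> conc (NE_parts lam Y) s -> sub true u s ->
  conc (NE_parts lam Y) u.
Proof.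
move=> u0 Cs; elim: Cs u u0 => [v Qv|v t Qv _ IH] u u0 Sub.
  by apply: conc1; apply: NE_parts_sub Sub.
case: (sub_cat u0 Sub) => [S|S|[u1 [u2 [n1 n2 -> S1 S2]]]].
- by apply: conc1; apply: NE_parts_sub S.
- exact: IH.
- by apply: conc_cat; [apply: NE_parts_sub S1|apply: IH].
Qed.

(** If the cut falls inside a factor, the step across it decides: the left piece of the factor is in
    North-East position for an East step, the right piece for a South step. *)
Lemma conc_split lam Y s t : s != [::] -> t != [::] -> sorted step (s ++ t) ->
  conc (NE_parts lam Y) (s ++ t) ->
  conc (NE_parts lam Y) s \/ conc (NE_parts lam Y) t.
Proof.
move=> s0 t0 S C; move: {-2}(s ++ t) C (erefl (s ++ t)) => w C.
elim: C s s0 S => [u Qu|u r Qu Cr IH] s s0 S E.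
  have [[] J] := sorted_joint S.
    by left; apply: conc1; apply: (NE_parts_sub s0 Qu); rewrite -E; apply: subL.
  right; apply: conc1; apply: (NE_parts_sub t0 Qu); rewrite -E.
  by rewrite -[true]/(~~ false); apply: subR.
case/cat_eq_cat: E => [[z [Es Er]]|[z [/eqP z0 Eu Et]]].
  have [z0|z0] := eqVneq z [::]; first by right; move: Cr; rewrite Er z0.
  have [|Cz|Ct] := IH z z0 _ (esym Er); last by right.
    by move: S; rewrite Es -catA => /sorted_cat_inv[].
  by left; rewrite Es; apply: conc_cat.
have Su : sorted step (s ++ z).
  by rewrite -Eu; case: Qu => -[].
have [[] J] := sorted_joint Su.
  by left; apply: conc1; apply: (NE_parts_sub s0 Qu); rewrite Eu; apply: subL.
right; rewrite Et; apply: conc_cat => //; apply: (NE_parts_sub z0 Qu).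
by rewrite Eu -[true]/(~~ false); apply: subR.
Qed.

Lemma gen_biclosed lam Y : biclosed lam (gen lam Y).
Proof.
case=> s t s0 t0 St; first by move=> /asboolP Cs /asboolP Ct; apply/asboolP/conc_app.
move=> /asboolPn Cs /asboolPn Ct; apply/asboolPn => C.
by case: (conc_split s0 t0 _ C) => //; case: St.
Qed.

(** If the first factor is left to the South, it is the required part; if to the East, the remainder
    is in West-South position and induction applies. *)
Lemma conc_WS lam Y s : sorted step s -> conc (NE_parts lam Y) s ->
  exists u, [/\ NE_parts lam Y u & sub false u s].
Proof.
move=> S C; elim: C S => [u Qu|u t Qu Ct IH] S.
  by exists u; split; [done|exact: sub_self].
have [[] J] := sorted_joint S; last by exists u; split=> //; apply: subL.
have [|v [Qv Sv]] := IH; first by case/sorted_cat_inv: S.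
exists v; split=> //; apply: sub_trans Sv _; first by case: Qv => /Seg_neq0.
by rewrite -[false]/(~~ true); apply: subR.
Qed.

(** By maximality an inclusion suffices. A West-South part of [p] in [gen lam F] would contain, in
    West-South position, a generator along which some path of [F] kisses [p]. *)
Lemma facet_cell lam F : GT lam F -> F = cell lam (gen lam F).
Proof.
move=> [DF maxF]; set B := gen lam F.
have [_ maxC] : GT lam (cell lam B) by apply/cell_facet/gen_biclosed.
have [FP Fb FK] := DF.
apply: maxC => //.
suff sFC : F `<=` cell lam B.
  by move=> p Cp; rewrite -(maxF _ (cell_face lam B) sFC).
move=> p Fp; split; [exact: FP|exact: Fb|].
case=> u Su Sup; first by apply/asboolP/conc1; split=> //; exists p.
apply/asboolPn => C; have [|v [[Sv [q Fq Svq]] Svu]] := conc_WS _ C.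
  by case: Su.
have v0 := Seg_neq0 Sv.
exact: (face_nokiss DF Fp Fq Sv (sub_trans v0 Svu Sup) Svq).
Qed.

(** * Descents *)

(** At a cut whose step has direction [e], the left piece is in position [e] and the right one in
    position [~~ e]; the values prescribed for them dictate exactly this step. *)
Lemma rigid_follow B s : sorted step s ->
  (forall d u, u != [::] -> size u < size s -> sub d u s -> B u = d) ->
  follow B s /\ bfollow B s.
Proof.
move=> S R; split=> a b E n0.
  have [->|b0] := eqVneq b [::]; first exact: joint_nilr.
  have [e J] : exists e, joint e a b by apply: sorted_joint; rewrite -E.
  rewrite (R e a) //; last by rewrite E; apply: subL.
  by rewrite E size_catr.
have [->|a0] := eqVneq a [::]; first by [].
have [e J] : exists e, joint e a b by apply: sorted_joint; rewrite -E.
rewrite (R (~~ e) b) ?negbK //; last by rewrite E; apply: subR.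
by rewrite E size_catl.
Qed.

(** [F'] is the lower facet and loses [p]; [F] is the upper one and gains [q]. *)
Definition exchange s (F' F : set (seq vertex)) p q : Prop :=
  [/\ F' p, F q, F' `\ p = F `\ q, sub false s p & sub true s q].

Lemma flip_exchange lam s F' F : flip lam s F' F ->
  [/\ Seg lam s, GT lam F', GT lam F & exists p q, exchange s F' F p q].
Proof.
case=> GF' GF [p [q [[F'p Fq] _ E [Ss _ _] K]]]; split=> //.
have Sp : sorted step p by case: GF' => -[FP _ _] _; apply: Paths_sorted (FP _ F'p).
have Sq : sorted step q by case: GF => -[FP _ _] _; apply: Paths_sorted (FP _ Fq).
by have [S1 S2] := kissP Sp Sq (Seg_neq0 Ss) K; exists p, q.
Qed.

(** Any path of [F] other than [q] also lies in [F'], where it may not kiss [p]. *)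
Lemma exchange_eq lam s F' F p q u r : DeltaNK lam F' -> exchange s F' F p q ->
  Seg lam u -> F r -> sub false u p -> sub true u r -> r = q.
Proof.
move=> DF' [F'p Fq E _ _] Su Fr Sup Sur; apply: contrapT => rq.
have [F'r _] : (F' `\ p) r by rewrite E.
exact: (face_nokiss DF' F'p F'r Su Sup Sur).
Qed.

(** Otherwise [u] contains, in West-South position, a generator [v] coming from some [r] in [F].
    Then [r] kisses [p] along [v], so [r] is [q]; but [v] is North-East in [q] and West-South in
    [s], which forces [v = s]. *)
Lemma exchange_notin_gen lam s F' F p q u : DeltaNK lam F' -> sorted step q ->
  Seg lam s -> exchange s F' F p q -> sub false u s -> u != [::] ->
  size u < size s -> gen lam F u = false.
Proof.
move=> DF' Sq Ss X Sus u0 us; apply/negbTE/asboolPn => C.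
have Su := Seg_sub u0 Ss Sus.
have [|v [[Sv [r Fr Svr]] Svu]] := conc_WS _ C; first by case: Su.
have v0 := Seg_neq0 Sv; have Svs := sub_trans v0 Svu Sus.
have [_ _ _ Ssp Ssq] := X.
have rq := exchange_eq DF' X Sv Fr (sub_trans v0 Svs Ssp) Svr.
rewrite rq in Svr.
have vs := sub_clash Sq v0 (sub_infix Ssq) Svs Svr.
by have := sub_size Svu; rewrite vs leqNgt us.
Qed.

(* If [s] and [t] in [Des lam F] are friendly along [u], then both descents
   exchange the same path [q] and [u] is [s], say [t = a ++ s ++ b].  The path of
   [F] determined by an end of [s] is [q]; the step of [q] entering [a] (leaving
   [b]) then puts [a] ([b]) in [gen lam F], which the exchange at [t] forbids. *)
Lemma Des_nonfriendly lam F s t u : Des lam F s -> Des lam F t -> s <> t ->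
  Seg lam u -> sub false u s -> sub true u t -> False.
Proof.
move=> [_ [F1 /flip_exchange[Ss [D1 _] GF [p1 [q1 X1]]]]].
move=> [_ [F2 /flip_exchange[St [D2 _] _ [p2 [q2 X2]]]]] st Su Sus Sut.
have u0 := Seg_neq0 Su; have s0 := Seg_neq0 Ss.
have [_ Fq1 _ Ssp Ssq] := X1; have [_ Fq2 _ Stp Stq] := X2.
have q21 : q2 = q1.
  by apply: (exchange_eq D1 X1 Su Fq2); [apply: sub_trans Ssp|apply: sub_trans Stq].
have Pq : Paths lam q1 by case: GF => -[FP _ _] _; apply: FP.
have Sq := Paths_sorted Pq; have Uq := step_uniq Sq.
rewrite {}q21 in X2 Fq2 Stq.
have us : u = s.
  exact: sub_clash Sq u0 (sub_infix Ssq) Sus (sub_trans u0 Sut Stq).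
rewrite us in Sut.
case: Sut => a [b [Et Ja Jb]].
have Bs : gen lam F s by apply/asboolP/conc1; split=> //; exists q1.
(* North-East parts of [s] are generators through [q1]; proper West-South parts are excluded by the
   exchange along [s]. *)
have [Fs bFs] : follow (gen lam F) s /\ bfollow (gen lam F) s.
  apply: rigid_follow => [|[] v v0 vs Sv]; first by case: Ss.
    apply/asboolP/conc1; split; first exact: Seg_sub Ss Sv.
    by exists q1 => //; apply: sub_trans Ssq.
  exact: exchange_notin_gen X1 Sv v0 vs.
have FC := facet_cell GF.
case: (Stq) => c [e [Eq Jc Je]]; have [c0 e0] := Paths_occ Pq St Eq.
have Eq' : q1 = (c ++ a) ++ s ++ (b ++ e) by rewrite Eq Et -!catA.
have [a0|a0] := eqVneq a [::]; last first.
  have [c' [r' [Cr Jc' Jr' bF]]] :=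
    cell_through_bwd (@gen_biclosed lam F) Ss Bs Fs.
  have E' : c' ++ s ++ r' = q1.
    apply: (exchange_eq D1 X1 Ss) => //; first by rewrite FC.
    by exists c', r'.
  have [Ec' _] : c' = c ++ a /\ r' = b ++ e.
    by apply: (occurrence_unique s0); rewrite E'.
  have := bF _ _ Ec' a0.
  rewrite (exchange_notin_gen D2 Sq St X2 _ a0).
  - move: Jc; rewrite Et joint_catr // => Jc /(joint_inj c0 a0 Jc).
    by [].
  - by rewrite Et; apply: subL; rewrite joint_catr.
  - by rewrite Et size_catr ?cat_neq0l.
have [b0|b0] := eqVneq b [::].
  by apply: st; rewrite Et a0 b0 cats0.
have [c' [r' [Cr Jc' Jr' Fw]]] :=
  cell_through_fwd (@gen_biclosed lam F) Ss Bs bFs.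
have E' : c' ++ s ++ r' = q1.
  apply: (exchange_eq D1 X1 Ss) => //; first by rewrite FC.
  by exists c', r'.
have [_ Er'] : c' = c ++ a /\ r' = b ++ e.
  by apply: (occurrence_unique s0); rewrite E'.
have := Fw _ _ Er' b0.
rewrite (exchange_notin_gen D2 Sq St X2 _ b0).
- by move: Je; rewrite Et a0 cat0s joint_catl // => Je /(joint_inj b0 e0 Je).
- by rewrite Et a0 -[false]/(~~ true); apply: subR.
- by rewrite Et catA size_catl ?cat_neq0r.
Qed.

Lemma follow_unique I B x w w' : follow B (x :: w) -> follow B (x :: w') ->
  terminal I (x :: w) -> terminal I (x :: w') -> w = w'.
Proof.
have last1 y : terminal I [:: y] -> ~~ I y.
  by case=> m [v [E _]]; case: m E => [[->]|? []].
have not_last y z v : terminal I (y :: z :: v) -> I y.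
  by case=> m [v' [E]]; case: m E => // ? m [<- _] /andP[].
elim: w x w' B => [|z w IH] x [|z' w'] B Fw Fw' Tw Tw' //.
- by have := last1 _ Tw; rewrite (not_last _ _ _ Tw').
- by have := last1 _ Tw'; rewrite (not_last _ _ _ Tw).
case/follow_cons: Fw => Ez Fw; case/follow_cons: Fw' => Ez' Fw'.
rewrite -Ez in Ez'; rewrite Ez' in Fw' Tw' *; congr cons.
apply: IH Fw Fw' _ _; first exact: (terminal_cons (w := z :: w) isT Tw).
exact: (terminal_cons (w := z :: w') isT Tw').
Qed.

Lemma bfollow_unique I B x w w' : bfollow B (rcons w x) ->
  bfollow B (rcons w' x) -> initial I (rcons w x) -> initial I (rcons w' x) ->
  w = w'.
Proof.
move=> /bfollow_mirror Fw /bfollow_mirror Fw' /initial_mirror Tw /initial_mirror Tw'.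
rewrite !mirror_rcons in Fw Fw' Tw Tw'.
by rewrite -(mirrorK w) (follow_unique Fw Fw' Tw Tw') mirrorK.
Qed.

Lemma Paths_terminal lam p a w : Paths lam p -> p = a ++ w -> a != [::] ->
  w != [::] -> terminal (interior lam) w.
Proof.
case=> v [y [m [-> _ _ /andP[_ ny] Im]]]; case: a => // x a.
case/lastP: w => // w z; rewrite -rcons_cat /= => -[_ /rcons_inj[Em Ey]] _ _.
exists w, z; rewrite -Ey; split=> //.
by move: Im; rewrite Em all_cat => /andP[].
Qed.

Lemma Paths_initial lam p w b : Paths lam p -> p = w ++ b -> w != [::] ->
  b != [::] -> initial (interior lam) w.
Proof.
case=> v [y [m [-> _ /andP[_ nv] _ Im]]]; case/lastP: b => [|b z]; first by case: w.
case: w => // x w; rewrite -rcons_cat /= => -[Ev /rcons_inj[Em _]] _ _.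
exists x, w; rewrite -Ev; split=> //.
by move: Im; rewrite Em all_cat => /andP[].
Qed.

(** The hypotheses force a path of the cell along [s] to be dictated by [B] forward from the start
    of [s] and backward from its end, which determines it. *)
Lemma cell_unique lam B d s p p' : Seg lam s -> B s = d ->
  (forall d u, u != [::] -> size u < size s -> sub d u s -> B u = d) ->
  (forall z, Seg lam z -> Seg lam (s ++ z) -> joint d s z -> B z = ~~ d ->
    B (s ++ z) = ~~ d) ->
  (forall z, Seg lam z -> Seg lam (z ++ s) -> joint (~~ d) z s -> B z = ~~ d ->
    B (z ++ s) = ~~ d) ->
  cell lam B p -> cell lam B p' -> sub d s p -> sub d s p' -> p = p'.
Proof.
move=> Ss Bs R Hr Hl Cp Cp'.
have s0 := Seg_neq0 Ss.
have [Fs bFs] : follow B s /\ bfollow B s by apply: rigid_follow R; case: Ss.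
have key c r : cell lam B (c ++ s ++ r) -> joint (~~ d) c s -> joint d s r ->
    follow B (s ++ r) /\ bfollow B (c ++ s).
  move=> [Pq _ Cq] Jc Jr; have [c0 r0] := Paths_occ Pq Ss erefl.
  have Sq := Paths_sorted Pq.
  split=> a b E n0.
    case/cat_eq_cat: E => [[z [Es Eb]]|[z [/eqP z0 Ea Er]]].
      have [z0|z0] := eqVneq z [::].
        by rewrite Eb z0 cats0 /= in Es *; rewrite -Es Bs.
      by rewrite Eb joint_catr //; apply: Fs.
    have [->|b0] := eqVneq b [::]; first exact: joint_nilr.
    have Eq : c ++ s ++ r = c ++ (s ++ z) ++ b by rewrite Er -!catA.
    have Ssz : Seg lam (s ++ z) := Paths_Seg Pq Eq c0 (cat_neq0l _ s0) b0.
    have Sz : Seg lam z by apply: (@Seg_cat _ s z [::]); rewrite ?cats0.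
    have Jz : joint d s z by move: Jr; rewrite Er joint_catr.
    have [e J] : exists e, joint e z b.
      by apply: sorted_joint; move: Sq; rewrite Er => /sorted_cat_inv[_ /sorted_cat_inv[]].
    rewrite Ea joint_catl //; suff -> : B (s ++ z) = e by [].
    (* A step in direction [d] puts [s ++ z] itself in position [d] in the path; otherwise [z] is in
       the opposite position and [Hr] passes its value on to [s ++ z]. *)
    have [ed|ed] := eqVneq e d.
      rewrite ed in J *; apply: Cq => //; exists c, b; split=> //.
        by rewrite joint_catr.
      by rewrite joint_catl.
    have {}ed : e = ~~ d by case: (e) (d) ed => -[].
    rewrite ed in J *; apply: Hr => //; apply: Cq => //.
    exists (c ++ s), b; split=> //; first by rewrite Eq -!catA.
    by rewrite negbK joint_catl.
  case/esym/cat_eq_cat: E => [[z [Ea Es]]|[z [/eqP z0 Ec Eb]]]; last first.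
    have [->|a0] := eqVneq a [::]; first by [].
    have Eq : c ++ s ++ r = a ++ (z ++ s) ++ r by rewrite Ec -!catA.
    have Szs : Seg lam (z ++ s) := Paths_Seg Pq Eq a0 (cat_neq0r _ s0) r0.
    have Sz : Seg lam z by apply: (@Seg_cat _ [::] z s).
    have Jz : joint (~~ d) z s by move: Jc; rewrite Ec joint_catl.
    have [e J] : exists e, joint e a z.
      by apply: sorted_joint; move: Sq; rewrite Ec => /sorted_cat_inv[].
    rewrite Eb joint_catr //; suff -> : B (z ++ s) = ~~ e by rewrite negbK.
    have [ed|ed] := eqVneq e d.
      rewrite ed in J *; apply: Hl => //; apply: Cq => //.
      exists a, (s ++ r); split=> //; first by rewrite Eq -!catA.
        by rewrite negbK.
      by rewrite joint_catr.
    have {}ed : e = ~~ d by case: (e) (d) ed => -[].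
    rewrite ed in J *; rewrite negbK; apply: Cq => //; exists a, r; split=> //.
      by rewrite joint_catr.
    by rewrite joint_catl.
  have [z0|z0] := eqVneq z [::].
    by rewrite Ea z0 cats0; move: Es; rewrite z0 /= => <-; rewrite Bs.
  by rewrite Ea joint_catl //; apply: bFs.
case=> c [r [Ep Jc Jr]] [c' [r' [Ep' Jc' Jr']]].
rewrite {}Ep in Cp *; rewrite {}Ep' in Cp' *.
have [Fw Bw] := key _ _ Cp Jc Jr; have [Fw' Bw'] := key _ _ Cp' Jc' Jr'.
have [Pp _ _] := Cp; have [Pp' _ _] := Cp'.
have [c0 r0] := Paths_occ Pp Ss erefl; have [c0' r0'] := Paths_occ Pp' Ss erefl.
have Tr := Paths_terminal Pp erefl c0 (cat_neq0l _ s0).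
have Tr' := Paths_terminal Pp' erefl c0' (cat_neq0l _ s0).
have Tc := Paths_initial Pp (catA _ _ _) (cat_neq0r _ s0) r0.
have Tc' := Paths_initial Pp' (catA _ _ _) (cat_neq0r _ s0) r0'.
have Er : s ++ r = s ++ r'.
  case: (s) s0 Fw Fw' Tr Tr' => // x s' _ Fw Fw' Tr Tr'.
  by congr cons; apply: follow_unique Fw Fw' Tr Tr'.
have Ec : c ++ s = c' ++ s.
  case/lastP: (s) s0 Bw Bw' Tc Tc' => // s' x _; rewrite -!rcons_cat.
  by move=> Bw Bw' Tc Tc'; congr rcons; apply: bfollow_unique Bw Bw' Tc Tc'.
by rewrite Er !catA Ec.
Qed.

(** * The facet of a nonfriendly set *)

(** One orientation is enough, since [s] and [t] range over ordered pairs. *)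
Definition nonfriendly lam (X : set (seq vertex)) : Prop :=
  forall s t u, X s -> X t -> s <> t -> Seg lam u ->
    sub false u s -> sub true u t -> False.

Lemma GammaNF_nonfriendly lam X : X `<=` Seg lam ->
  GammaNF lam X <-> nonfriendly lam X.
Proof.
move=> XS; split=> [[_ NF] s t u Xs Xt st Su Sus Sut|NF].
  have [u0 [_ Ss _] [_ St _]] := And3 (Seg_neq0 Su) (XS _ Xs) (XS _ Xt).
  apply: (NF s t Xs Xt st u); split; last by left; apply/friendlyP.
  by split=> //; [apply: sub_infix Sus|apply: sub_infix Sut].
split=> // s t Xs Xt st u [[Su _ _]].
have [u0 [_ Ss _] [_ St _]] := And3 (Seg_neq0 Su) (XS _ Xs) (XS _ Xt).
case=> /friendlyP-[] // S1 S2; first exact: NF S1 S2.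
by apply: NF S1 S2 => // /esym.
Qed.

(** The member of [X] providing [u] contains [s] in North-East position, so it would be friendly
    with [s] along [s] itself unless equal to it. *)
Lemma nonfriendly_through lam X s u : nonfriendly lam X -> X s -> Seg lam s ->
  NE_parts lam X u -> sub true s u -> u = s.
Proof.
move=> NF Xs Ss [Su [x Xx Sux]] Ssu.
have [sx|sx] := pselect (s = x); last first.
  by case: (NF s x s Xs Xx sx Ss (sub_self _ _) (sub_trans (Seg_neq0 Ss) Ssu Sux)).
by rewrite -sx in Sux; apply/esym/(sub_size_eq Ssu)/(sub_size Sux).
Qed.

(** A generator inside [u], in West-South position, is common to [s] and the member of [X] providing
    it; that member must be [s], and the generator is then all of [s]. *)
Lemma nonfriendly_WS lam X s u : nonfriendly lam X -> X s -> Seg lam s ->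
  conc (NE_parts lam X) u -> sub false u s -> u = s.
Proof.
move=> NF Xs Ss C Sus.
have Su := Seg_sub (conc_neq0 C) Ss Sus.
have [|v [[Sv [x Xx Svx]] Svu]] := conc_WS _ C; first by case: Su.
have v0 := Seg_neq0 Sv; have Svs := sub_trans v0 Svu Sus.
have [sx|sx] := pselect (s = x); last by case: (NF s x v Xs Xx sx Sv Svs Svx).
rewrite -sx in Svx; have vs : v = s.
  by apply: (sub_clash _ v0 _ Svs Svx); [case: Ss|apply: infix_refl].
by apply: (sub_size_eq Sus); rewrite -vs; apply: sub_size Svu.
Qed.

(** Whichever way the step at the cut goes, one of the two pieces is a proper part of [s] in
    West-South position. *)
Lemma nonfriendly_indecomposable lam X s s1 s2 : nonfriendly lam X -> X s ->
  Seg lam s -> s = s1 ++ s2 -> conc (NE_parts lam X) s1 ->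
  ~ conc (NE_parts lam X) s2.
Proof.
move=> NF Xs Ss Es C1 C2.
have /sorted_joint[[] J] : sorted step (s1 ++ s2) by rewrite -Es; case: Ss.
  have := nonfriendly_WS NF Xs Ss C2; rewrite Es => /(_ (subR J)) E.
  by have := size_catl s2 (conc_neq0 C1); rewrite -E ltnn.
have := nonfriendly_WS NF Xs Ss C1; rewrite Es => /(_ (subL J)) E.
by have := size_catr s1 (conc_neq0 C2); rewrite -E ltnn.
Qed.

(** A factor containing [s] equals [s], and no cut between factors falls inside [s] because [s] is
    indecomposable; so [a] and [b] are concatenations of whole factors. *)
Lemma conc_through lam X s a b : nonfriendly lam X -> X s -> Seg lam s ->
  conc (NE_parts lam X) (a ++ s ++ b) -> joint false a s -> joint true s b ->
  (a != [::] -> conc (NE_parts lam X) a) /\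
  (b != [::] -> conc (NE_parts lam X) b).
Proof.
move=> NF Xs Ss C; have s0 := Seg_neq0 Ss.
have one u c e : NE_parts lam X u -> u = c ++ s ++ e -> joint false c s ->
    joint true s e -> c = [::] /\ e = [::].
  move=> Qu E Jc Je; have := nonfriendly_through NF Xs Ss Qu.
  rewrite E => /(_ (ex_intro _ c (ex_intro _ e (And3 erefl Jc Je)))).
  move/(congr1 size); rewrite !size_cat => H.
  by split; apply: size0nil; lia.
move: {-2}(a ++ s ++ b) C (erefl (a ++ s ++ b)) => w C.
elim: C a b => [u Qu|u t Qu Ct IH] a b.
  by move=> /esym E Ja Jb; have [-> ->] := one _ _ _ Qu E Ja Jb.
move=> /esym/cat_eq_cat3[[b1 [Eu Eb]]|[a2 [Et Ea]]|].
- move=> Ja; rewrite Eb => Jb.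
  have [|-> b1z] := one _ _ b1 Qu Eu Ja.
    have [->|n1] := eqVneq b1 [::]; first exact: joint_nilr.
    by move: Jb; rewrite joint_catr.
  by rewrite b1z.
- rewrite Ea => Ja Jb.
  have J2 : joint false a2 s.
    by have [->|n2] := eqVneq a2 [::]; last by move: Ja; rewrite joint_catl.
  have [Ca Cb] := IH a2 b (esym Et) J2 Jb; split=> // _.
  have [->|n2] := eqVneq a2 [::]; first by rewrite cats0; apply: conc1.
  by apply: conc_cat => //; apply: Ca.
- case=> s1 [s2 [/eqP n1 /eqP n2 Es Eu Et]] Ja Jb.
  have C1 : conc (NE_parts lam X) s1.
    apply: conc1; apply: (NE_parts_sub n1 Qu).
    exists a, [::]; rewrite cats0 joint_nilr; split=> //.
    by move: Ja; rewrite Es joint_catr.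
  have C2 : conc (NE_parts lam X) s2.
    apply: (conc_NE n2 Ct); exists [::], b; split=> //.
    by move: Jb; rewrite Es joint_catl.
  by case: (nonfriendly_indecomposable NF Xs Ss Es C1 C2).
Qed.

(* The part of [gen lam X] generating the facet below [cell lam (gen lam X)]
   across the descent [s]. *)
Definition lower lam (X : set (seq vertex)) s (u : seq vertex) : bool :=
  gen lam X u && ~~ `[< sub true s u >].

(** Closure: an occurrence of [s] created by concatenation would straddle the cut and decompose [s].
    Coclosure: the piece in North-East position stays in [gen lam X] and cannot contain [s] in that
    position if the whole does not. *)
Lemma lower_biclosed lam X s : nonfriendly lam X -> X s -> Seg lam s ->
  biclosed lam (lower lam X s).
Proof.
move=> NF Xs Ss; have s0 := Seg_neq0 Ss.
case=> t1 t2 n1 n2 St.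
  move=> /andP[G1 /asboolPn N1] /andP[G2 /asboolPn N2].
  apply/andP; split; first exact: (gen_biclosed n1 n2 St).
  apply/asboolPn => /(sub_cat s0)[] // [s1 [s2 [m1 m2 Es S1 S2]]].
  move/asboolP: G1 => G1; move/asboolP: G2 => G2.
  have C1 := conc_NE m1 G1 S1; have C2 := conc_NE m2 G2 S2.
  exact: (nonfriendly_indecomposable NF Xs Ss Es C1 C2).
move=> L1 L2; apply/negP => /andP[/asboolP G /asboolPn N].
have [[] J] : exists e, joint e t1 t2 by apply: sorted_joint; case: St.
  move/negP: L1; apply; apply/andP; split.
    by apply/asboolP; apply: (conc_NE n1 G); apply: subL.
  by apply/asboolPn => S; apply: N; apply: sub_trans S _ => //; apply: subL.
have J' : sub true t2 (t1 ++ t2) by rewrite -[true]/(~~ false); apply: subR.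
move/negP: L2; apply; apply/andP; split.
  by apply/asboolP; apply: (conc_NE n2 G).
by apply/asboolPn => S; apply: N; apply: sub_trans S _.
Qed.

Lemma nonfriendly_Des lam X s : X `<=` Seg lam -> nonfriendly lam X -> X s ->
  Des lam (cell lam (gen lam X)) s.
Proof.
move=> XS NF Xs; have Ss := XS _ Xs; have s0 := Seg_neq0 Ss; split=> //.
set B := gen lam X; set B' := lower lam X s.
have bB : biclosed lam B by apply: gen_biclosed.
have bB' : biclosed lam B' by apply: lower_biclosed.
have Ssub d u : u != [::] -> sub d u s -> Seg lam u by move=> u0; apply: Seg_sub.
have Q u : u != [::] -> sub true u s -> B u.
  move=> u0 Su; apply/asboolP/conc1; split; first exact: Ssub Su.
  by exists s.
have small u : size u < size s -> ~ sub true s u.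
  by move=> us /sub_size; rewrite leqNgt us.
have R d u : u != [::] -> size u < size s -> sub d u s -> B u = d.
  case: d => u0 us Su; first exact: Q.
  apply/negbTE/asboolPn => C.
  by move: us; rewrite (nonfriendly_WS NF Xs Ss C Su) ltnn.
have R' d u : u != [::] -> size u < size s -> sub d u s -> B' u = d.
  move=> u0 us Su; rewrite /B' /lower -/B (R d) //.
  by rewrite (introT (asboolPn _) (small _ us)) andbT.
have Bs : B s = true by apply: Q => //; apply: sub_self.
have B's : B' s = false by rewrite /B' /lower (introT (asboolP _) (sub_self _ _)) andbF.
have through u a b : B u -> u = a ++ s ++ b -> joint false a s ->
    joint true s b -> (a != [::] -> B a) /\ (b != [::] -> B b).
  move=> /asboolP C E Ja Jb; rewrite E in C.
  by have [Ca Cb] := conc_through NF Xs Ss C Ja Jb; split=> n; apply/asboolP; auto.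
(* In each of the two cells, the path to be exchanged is the only one running along [s] in its
   position. *)
have uniqQ p p' : cell lam B p -> cell lam B p' -> sub true s p ->
    sub true s p' -> p = p'.
  apply: (cell_unique Ss Bs R) => z Sz Szs J Bz; apply/negP => Bzs.
    have [_ H] := through _ [::] z Bzs erefl isT J.
    by move: Bz; rewrite H // (Seg_neq0 Sz).
  have [H _] := through _ z [::] Bzs (congr1 _ (esym (cats0 s))) J (joint_nilr _ _).
  by move: Bz; rewrite H // (Seg_neq0 Sz).
have NEs t : Seg lam t -> sub false s t -> t <> s -> ~ sub true s t.
  move=> [_ St _] S1 ts S2; apply: ts; apply/esym.
  exact: (sub_clash St s0 (infix_refl t) S1 S2).
have uniqP p p' : cell lam B' p -> cell lam B' p' -> sub false s p ->
    sub false s p' -> p = p'.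
  apply: (cell_unique Ss B's R') => z Sz Szs J /andP[Bz _]; have z0 := Seg_neq0 Sz.
    apply/andP; split; first by apply: bB.
    apply/asboolPn/NEs => //; first exact: subL.
    by move=> E; have := size_catr s z0; rewrite E ltnn.
  apply/andP; split; first by apply: bB.
  apply/asboolPn/NEs => //; first by rewrite -[false]/(~~ true); apply: subR.
  by move=> E; have := size_catl s z0; rewrite E ltnn.
have Sort : sorted step s by case: Ss.
have [c [r [Cq Jc Jr _]]] := cell_through_fwd bB Ss Bs (proj2 (rigid_follow Sort R)).
have Sq : sub true s (c ++ s ++ r) by exists c, r.
have [c' [r' [Cp Jc' Jr' _]]] :=
  cell_through_fwd bB' Ss B's (proj2 (rigid_follow Sort R')).
have Sp : sub false s (c' ++ s ++ r') by exists c', r'.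
move: (c ++ s ++ r) Cq Sq (c' ++ s ++ r') Cp Sp => q Cq Sq p Cp Sp.
have [Pp _ _] := Cp; have [Pq _ _] := Cq.
exists (cell lam B'); split; [exact: cell_facet|exact: cell_facet|].
exists p, q; split=> //.
- by move=> E; rewrite E in Sp; have := Paths_sub_inj Pq Ss Sp Sq.
- rewrite eqEsubset; split=> t [Ct /= tn]; have [Pt bt Kt] := Ct.
    split; last first.
      by move=> E; rewrite E in Kt; have := Kt true s Ss Sq; rewrite B's.
    (* A violation is a West-South part [u = a ++ s ++ b] of [t], in [B] but not in [B']. A nonempty
       [a] or [b] is in [B] and West-South in [t], hence outside [B'], so it would contain [s] a
       second time. Thus [u] is [s] and [t] is [p]. *)
    split=> // d u Su Sut; apply/eqP/negPn/negP => /eqP Bd.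
    have := Kt d u Su Sut; rewrite /B' /lower -/B => E.
    case: d Sut E Bd => Sut; first by case/andP.
    move=> /negbT; rewrite negb_and negbK => /orP[/negbTE //|/asboolP Ssu].
    case BE : (B u) => // _; case: Ssu => a [b [Eu Ja Jb]].
    have [Ba Bb] := through _ _ _ BE Eu Ja Jb.
    have Uu : uniq (a ++ s ++ b) by rewrite -Eu; apply: step_uniq; case: Su.
    have [a0|a0] := eqVneq a [::]; last first.
      have Sau : sub false a u by rewrite Eu; apply: subL; rewrite joint_catr.
      have := Kt false a (Seg_sub a0 Su Sau) (sub_trans a0 Sau Sut).
      rewrite /B' /lower -/B Ba //= => /negbFE/asboolP/sub_infix.
      by rewrite (negPf (uniq_cat_infixl s0 Uu)).
    have [b0|b0] := eqVneq b [::]; last first.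
      have Sbu : sub false b u.
        by rewrite Eu catA -[false]/(~~ true); apply: subR; rewrite joint_catl.
      have := Kt false b (Seg_sub b0 Su Sbu) (sub_trans b0 Sbu Sut).
      rewrite /B' /lower -/B Bb //= => /negbFE/asboolP/sub_infix.
      by rewrite (negPf (uniq_cat_infixr s0 Uu)).
    apply: tn; apply: uniqP => //; move: Sut.
    by rewrite Eu a0 b0 cats0.
  split; last by move=> E; rewrite E in Kt; have := Kt false s Ss Sp; rewrite Bs.
  (* Only a North-East part of [t] containing [s] in North-East position could be lost in passing to
     [B'], and this would make [t] equal to [q]. *)
  split=> // d u Su Sut; have Bu := Kt d u Su Sut.
  rewrite /B' /lower -/B Bu; case: d Sut Bu => // Sut _.
  apply/asboolPn => Ssu; apply: tn; apply: uniqQ => //.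
  exact: sub_trans s0 Ssu Sut.
- split; first by [].
  + exact: sub_infix Sp.
  + exact: sub_infix Sq.
- exact: sub_kiss Pp Pq Ss Sp Sq.
Qed.

Lemma Des_cell_sub lam X : X `<=` Seg lam -> nonfriendly lam X ->
  Des lam (cell lam (gen lam X)) `<=` X.
Proof.
move=> XS NF s Ds; have [Ss [F' /flip_exchange[_ _ _ [p [q [_ [_ _ Cq] _ _ Sq]]]]]] := Ds.
have /asboolP C := Cq _ _ Ss Sq.
have [|u [[Su [x Xx Sux]] Sus]] := conc_WS _ C; first by case: Ss.
have [->//|sx] := pselect (s = x).
by case: (Des_nonfriendly Ds (nonfriendly_Des XS NF Xx) sx Su Sus Sux).
Qed.

Theorem corollary4p11 (lam : {fset vertex}) (X : set (seq vertex))
    (X_Seg : X `<=` Seg lam) :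
  (exists2 F : set (seq vertex), GT lam F & X = Des lam F) <-> GammaNF lam X.
Proof.
split=> [[F GF EX]|/(GammaNF_nonfriendly X_Seg) NF].
  apply/GammaNF_nonfriendly => // s t u; rewrite EX => Ds Dt.
  exact: Des_nonfriendly Ds Dt.
exists (cell lam (gen lam X)); first exact/cell_facet/gen_biclosed.
rewrite eqEsubset; split=> [s Xs|]; first exact: nonfriendly_Des.
exact: Des_cell_sub.
Qed.
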